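(* Let $\emptyset\neq\mathcal{Y}\subseteq\mathbb{R}^n$ and $u\in\mathcal{Y}$. Let $\mathbf{\Phi}_1,\mathbf{\Phi}_2:\mathcal{Y}\to I(\mathbb{R})$ be $gH$-weak subdifferentiable at $u$, and suppose $u$ is a weak efficient point of $\mathbf{\Phi}_2\ominus_{gH}\mathbf{\Phi}_1$. If either $w(\mathbf{\Phi}_1(y))\ge w(\mathbf{\Phi}_2(y))$ for all $y\in\mathcal{Y}$, or $w(\mathbf{\Phi}_1(y))\le w(\mathbf{\Phi}_2(y))$ for all $y\in\mathcal{Y}$, where $w(\mathbf{A})$ denotes the width of the interval $\mathbf{A}$, then $$\partial^w\mathbf{\Phi}_1(u)\subset\partial^w\mathbf{\Phi}_2(u).$$
   Context: $I(\mathbb{R})$ is the set of compact intervals $\mathbf{X}=[\underline{x},\overline{x}]$, $\underline{x}\le\overline{x}$; the width is $w(\mathbf{X})=\overline{x}-\underline{x}$; a real number $c$ is identified with $[c,c]$. Operations: $\mathbf{X}\oplus\mathbf{Y}=[\underline{x}+\underline{y},\overline{x}+\overline{y}]$; $\lambda\odot\mathbf{X}=[\min\{\lambda\underline{x},\lambda\overline{x}\},\max\{\lambda\underline{x},\lambda\overline{x}\}]$ for $\lambda\in\mathbb{R}$; $gH$-difference $\mathbf{X}\ominus_{gH}\mathbf{Y}=[\min\{\underline{x}-\underline{y},\overline{x}-\overline{y}\},\max\{\underline{x}-\underline{y},\overline{x}-\overline{y}\}]$. Order: $\mathbf{X}\preceq\mathbf{Y}$ iff $\underline{x}\le\underline{y}$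 and $\overline{x}\le\overline{y}$. For $\widehat{\mathbf{G}}=(\mathbf{G}_1,\dots,\mathbf{G}_n)\in I(\mathbb{R})^n$ and $d\in\mathbb{R}^n$, $\widehat{\mathbf{G}}^\top\odot d=\bigoplus_{i=1}^n d_i\odot\mathbf{G}_i$. $\mathbb{R}_+=[0,\infty)$ and $\|\cdot\|$ is the Euclidean norm. $(\mathbf{\Phi}_2\ominus_{gH}\mathbf{\Phi}_1)(y)=\mathbf{\Phi}_2(y)\ominus_{gH}\mathbf{\Phi}_1(y)$. The $gH$-weak subdifferential of $\mathbf{\Phi}:\mathcal{Y}\to I(\mathbb{R})$ at $u\in\mathcal{Y}$ is $$\partial^w\mathbf{\Phi}(u)=\{(\widehat{\mathbf{G}},c)\in I(\mathbb{R})^n\times\mathbb{R}_+:\ \widehat{\mathbf{G}}^\top\odot(y-u)\ominus_{gH}c\|y-u\|\preceq\mathbf{\Phi}(y)\ominus_{gH}\mathbf{\Phi}(u)\ \ \forall y\in\mathcal{Y}\};$$ $\mathbf{\Phi}$ is $gH$-weak subdifferentiable at $u$ if this set is nonempty. A point $u\in\mathcal{Y}$ is a weak efficient point of $\mathbf{\Phi}$ if $\mathbf{\Phi}(u)\preceq\mathbf{\Phi}(y)$ for all $y\in\mathcal{Y}$. The symbol $\subset$ denotes (not necessarily strict) inclusion. *)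

(* Defs.v *)
From mathcomp Require Import all_boot all_order all_algebra.
From mathcomp Require Import all_classical all_reals.

Set Implicit Arguments.
Unset Strict Implicit.
Unset Printing Implicit Defensive.

Import Order.TTheory GRing.Theory Num.Theory.
Local Open Scope classical_set_scope.
Local Open Scope ring_scope.

Record cinterval (R : realType) := CInterval {
  lo : R;
  hi : R;
  lo_le_hi : lo <= hi }.

Lemma min_le_max (R : realType) (a b : R) : Num.min a b <= Num.max a b.
Proof. by rewrite ge_min le_max lexx. Qed.

Definition width (R : realType) (X : cinterval R) : R := hi X - lo X.

Definition cpoint (R : realType) (c : R) : cinterval R := CInterval (lexx c).

Definition cadd (R : realType) (X Y : cinterval R) : cinterval R :=
  CInterval (lerD (lo_le_hi X) (lo_le_hi Y)).

Definition cscale (R : realType) (l : R) (X : cinterval R) : cinterval R :=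
  CInterval (min_le_max (l * lo X) (l * hi X)).

Definition gHsub (R : realType) (X Y : cinterval R) : cinterval R :=
  CInterval (min_le_max (lo X - lo Y) (hi X - hi Y)).

Definition cle (R : realType) (X Y : cinterval R) : Prop :=
  lo X <= lo Y /\ hi X <= hi Y.

Definition cdot (R : realType) (n : nat)
    (G : 'rV[cinterval R]_n) (d : 'rV[R]_n) : cinterval R :=
  \big[@cadd R/cpoint 0]_(i < n) cscale (d 0 i) (G 0 i).

(* The library norm `|x| on row vectors is the sup norm, hence this one. *)
Definition enorm (R : realType) (n : nat) (x : 'rV[R]_n) : R :=
  Num.sqrt (\sum_(i < n) x 0 i ^+ 2).

(* A map on a set [Y] is a function on the associated subtype: in [Y -> _],
   [Y] is coerced to [set_type Y], and [val] embeds it into R^n. *)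
Definition gHsub_fun (R : realType) (n : nat) (Y : set 'rV[R]_n)
    (Phi2 Phi1 : Y -> cinterval R) : Y -> cinterval R :=
  fun y => gHsub (Phi2 y) (Phi1 y).

Definition gHweak_subdiff (R : realType) (n : nat) (Y : set 'rV[R]_n)
    (Phi : Y -> cinterval R) (u : Y) : set ('rV[cinterval R]_n * R) :=
  [set Gc | 0 <= Gc.2 /\
    forall y : Y,
      cle (gHsub (cdot Gc.1 (val y - val u))
                 (cpoint (Gc.2 * enorm (val y - val u))))
          (gHsub (Phi y) (Phi u))].

Definition gHweak_subdifferentiable (R : realType) (n : nat)
    (Y : set 'rV[R]_n) (Phi : Y -> cinterval R) (u : Y) : Prop :=
  gHweak_subdiff Phi u !=set0.

Definition weak_efficient (R : realType) (n : nat) (Y : set 'rV[R]_n)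
    (Phi : Y -> cinterval R) (u : Y) : Prop :=
  forall y : Y, cle (Phi u) (Phi y).

(* Main.v *)
Require Import Defs.
From mathcomp Require Import all_boot all_order all_algebra.
From mathcomp Require Import all_classical all_reals.
From mathcomp Require Import lra.
Import Order.TTheory GRing.Theory Num.Theory.
Local Open Scope classical_set_scope.
Local Open Scope ring_scope.

(** By transitivity of the order it suffices that the $gH$-increment of [Phi1] from [u] to [y] lies
    below that of [Phi2]. The width hypothesis turns efficiency of [u] into real inequalities on
    lower and on upper endpoints ([gHsub_width_le], [gHsub_width_ge]); rearranged, these compare the
    increments by [cle_gHsub]. *)

Lemma cle_trans {R : realType} {X Y Z : cinterval R} :
  cle X Y -> cle Y Z -> cle X Z.
Proof. by move=> [l1 h1] [l2 h2]; split; [exact: le_trans l2 | exact: le_trans h2]. Qed.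

(** [min] and [max] are monotone in each argument, whichever endpoint difference is the smaller on
    either side. *)
Lemma cle_gHsub {R : realType} {X Y X' Y' : cinterval R} :
  lo X - lo Y <= lo X' - lo Y' -> hi X - hi Y <= hi X' - hi Y' ->
  cle (gHsub X Y) (gHsub X' Y').
Proof.
move=> lel leh; split=> /=.
  by rewrite le_min !ge_min lel leh orbT.
by rewrite ge_max !le_max lel leh orbT.
Qed.

(** The sign of [(hi X - hi Y) - (lo X - lo Y) = width X - width Y] decides which difference is the
    minimum. *)
Lemma gHsub_width_le {R : realType} {X Y : cinterval R} :
  width X <= width Y ->
  lo (gHsub X Y) = hi X - hi Y /\ hi (gHsub X Y) = lo X - lo Y.
Proof.
rewrite /width => wXY; have le_hl : hi X - hi Y <= lo X - lo Y by lra.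
by split=> /=; [exact: min_r | exact: max_l].
Qed.

Lemma gHsub_width_ge {R : realType} {X Y : cinterval R} :
  width Y <= width X ->
  lo (gHsub X Y) = lo X - lo Y /\ hi (gHsub X Y) = hi X - hi Y.
Proof.
rewrite /width => wYX; have le_lh : lo X - lo Y <= hi X - hi Y by lra.
by split=> /=; [exact: min_l | exact: max_r].
Qed.

Theorem theorem12 (R : realType) (n : nat) (Y : set 'rV[R]_n)
  (Y_neq0 : Y !=set0) (u : Y) (Phi1 Phi2 : Y -> cinterval R)
  (Phi1_subdiff : gHweak_subdifferentiable Phi1 u)
  (Phi2_subdiff : gHweak_subdifferentiable Phi2 u)
  (u_efficient : weak_efficient (gHsub_fun Phi2 Phi1) u)
  (width_cmp : (forall y : Y, width (Phi2 y) <= width (Phi1 y)) \/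
               (forall y : Y, width (Phi1 y) <= width (Phi2 y))) :
  gHweak_subdiff Phi1 u `<=` gHweak_subdiff Phi2 u.
Proof.
move=> [G c] [c_ge0 subG]; split=> // y; apply: cle_trans (subG y) _.
(* A width comparison valid at both [u] and [y] makes the min and max of the
   gH-difference select the same endpoints there, so efficiency can be read
   endpoint by endpoint. *)
have [lo_uy hi_uy] : lo (Phi2 u) - lo (Phi1 u) <= lo (Phi2 y) - lo (Phi1 y) /\
                     hi (Phi2 u) - hi (Phi1 u) <= hi (Phi2 y) - hi (Phi1 y).
  case: (u_efficient y); rewrite /gHsub_fun.
  case: width_cmp => w12.
    have [-> ->] := gHsub_width_le (w12 u).
    by have [-> ->] := gHsub_width_le (w12 y).
  have [-> ->] := gHsub_width_ge (w12 u).
  by have [-> ->] := gHsub_width_ge (w12 y).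
(* Exchanging the [Phi1 y] and [Phi2 u] terms across each inequality turns differences between the
   maps into increments from [u] to [y]. *)
by apply: cle_gHsub; lra.
Qed.
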